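(* Let $R\in(0,1)$ be such that $\max\big(|\beta_1(\alpha)|,|\boldsymbol\alpha(\beta_1(\alpha),\alpha)|\big)<1$ for all $\alpha\in\mathbb{C}$ with $R<|\alpha|\le1$. Let $K\ge 0$, let $c_0,c_1,\dots,c_K\in\mathbb{C}$, and let $\alpha_1,\dots,\alpha_K\in\mathbb{C}$ with $R<|\alpha_k|\le 1$ (and such that each $h_{\beta_1(\alpha_k)}$ is defined). Define $$h^{a,K}=\Re(h^{a*,K}),\qquad h^{a*,K}={\bm h}_r+c_0h_{\rho_1}+\sum_{k=1}^K c_k\,h_{\beta_1(\alpha_k)}.$$ Then $h^{a,K}$ is $Y$-harmonic and $\partial B$-determined. Furthermore, $$c^*=\sup_{y\in\partial B}|h^{a*,K}(y)-1|<\infty,$$ and $h^{a*,K}$ approximates $P_y(\tau<\infty)$ with relative error bounded by $c^*$, i.e. $|h^{a*,K}(y)-P_y(\tau<\infty)|\le c^*P_y(\tau<\infty)$ for $y\in B$.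
   Context: Parameters: $\lambda_1,\lambda_2,\mu_1,\mu_2>0$ with $\lambda_1+\lambda_2+\mu_1+\mu_2=1$; $\rho_i=\lambda_i/\mu_i$, $r=(\lambda_1+\lambda_2)/(\mu_1+\mu_2)$. Standing assumptions: $\rho_1,\rho_2<1$, $\rho_2\le r\le\rho_1$, $\rho_1\ne\rho_2$, $r^2/\rho_2<1$. $Y$ is the random walk on $\mathbb{Z}\times\mathbb{Z}_+$ with i.i.d. increments $J_k$, $P(J_k=(-1,0))=\lambda_1$, $P(J_k=(1,0))=\mu_1$, $P(J_k=(0,1))=\lambda_2$, $P(J_k=(0,-1))=\mu_2$: it moves by the next increment if this keeps it in $\mathbb{Z}\times\mathbb{Z}_+$, and otherwise does not move. $B=\{y\in\mathbb{Z}\times\mathbb{Z}_+: y(1)\ge y(2)\}$, $\partial B=\{y\in\mathbb{Z}\times\mathbb{Z}_+:y(1)=y(2)\}$, $\tau=\inf\{k\ge0:Y_k\in\partial B\}$; $P_y$, $\mathbb{E}_y$ refer to $Y$ started at $y$. A function $h$ on $\mathbb{Z}\times\mathbb{Z}_+$ is $Y$-harmonic if $\mathbb{E}_y[h(Y_1)]=h(y)$ for all $y\in\mathbb{Z}\times\mathbb{Z}_+$; it is $\partial B$-determined if there is a function $g$ on $\partial B$ with $h(y)=\mathbb{E}_y[g(Y_\tau)1_{\{\tau<\infty\}}]$ for all $y\in B$. For $\beta,\alpha\in\mathbb{C}\setminus\{0\}$: $[(\beta,\alpha),y]=\beta^{y(1)-y(2)}\alpha^{y(2)}$, $C(\beta,\alpha)=1-\beta/\alpha$,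 and $\boldsymbol\alpha(\beta,\alpha)=\frac{\beta^2}{\alpha\rho_2}$. For $\alpha\ne0$, $$\beta_1(\alpha)=\frac{1-\sqrt{\Delta(\alpha)}}{2(\mu_2/\alpha+\mu_1)},\quad \Delta(\alpha)=1-4\Big(\frac{\mu_2}{\alpha}+\mu_1\Big)(\lambda_1+\lambda_2\alpha),$$ where $\sqrt{\cdot}$ is the square root with nonnegative real part (if $\mu_2/\alpha+\mu_1=0$, $\beta_1(\alpha)$ is understood as the limiting value $\lambda_1+\lambda_2\alpha$). With $\beta=\beta_1(\alpha)$ and $\alpha'=\boldsymbol\alpha(\beta,\alpha)$, the function $$h_{\beta_1(\alpha)}=C(\beta,\alpha')[(\beta,\alpha),\cdot]-C(\beta,\alpha)[(\beta,\alpha'),\cdot]$$ is defined when $\beta\ne0$ and $\alpha\neq\alpha'$. Finally ${\bm h}_r=[(r,1),\cdot]-\frac{1-r}{1-\rho_2/r}[(r,r^2/\rho_2),\cdot]$ and $h_{\rho_1}=[(\rho_1,\rho_1),\cdot]$. *)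

(* Defs.v *)
From mathcomp Require Import all_boot all_order all_algebra.
From mathcomp Require Import all_classical all_reals all_analysis.
From mathcomp Require Import complex.

Set Implicit Arguments.
Unset Strict Implicit.
Unset Printing Implicit Defensive.

Import Order.TTheory GRing.Theory Num.Theory.

Local Open Scope classical_set_scope.
Local Open Scope ring_scope.
Local Open Scope complex_scope.

Notation cnorm := ComplexField.Normc.normc.

(* Points of Z x Z_+. *)
Definition state : Type := (int * nat)%type.

Definition B : set state := [set y | (y.2%:Z <= y.1)%R].
Definition dB : set state := [set y | y.1 = y.2%:Z].

Section Walk.
Context d (Omega : measurableType d) (R : realType).
Variable P : probability Omega R.

(* The increments take values in the countable set Z x Z, which carries the
   discrete sigma-algebra: every set of values is measurable. *)
Definition measurable_increments (J : nat -> Omega -> int * int) : Prop :=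
  forall k (A : set (int * int)), measurable (J k @^-1` A).

Definition mutually_independent (J : nat -> Omega -> int * int) : Prop :=
  forall (s : seq nat) (A : nat -> set (int * int)), uniq s ->
    P (\bigcap_(k in [set` s]) (J k @^-1` A k)) =
    (\prod_(k <- s) P (J k @^-1` A k))%E.

Definition increment_law (lam1 lam2 mu1 mu2 : R) (X : Omega -> int * int)
    : Prop :=
  [/\ P (X @^-1` [set (- 1, 0)]) = lam1%:E,
      P (X @^-1` [set (1, 0)]) = mu1%:E,
      P (X @^-1` [set (0, 1)]) = lam2%:E &
      P (X @^-1` [set (0, - 1)]) = mu2%:E].

Definition iid_increments (lam1 lam2 mu1 mu2 : R)
    (J : nat -> Omega -> int * int) : Prop :=
  [/\ measurable_increments J, mutually_independent J &
      forall k, increment_law lam1 lam2 mu1 mu2 (J k)].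

Definition step (y : state) (j : int * int) : state :=
  if 0 <= y.2%:Z + j.2 then (y.1 + j.1, `|(y.2%:Z + j.2)%R|%N) else y.

(* Y_k started at y; the increment leading from Y_k to Y_(k+1) is J k. *)
Fixpoint walk (J : nat -> Omega -> int * int) (y : state) (k : nat)
    (w : Omega) : state :=
  if k is k'.+1 then step (walk J y k' w) (J k' w) else y.

(* The hitting time of dB, with None standing for +oo. *)
Definition tau (J : nat -> Omega -> int * int) (y : state) (w : Omega)
    : option nat :=
  match pselect (exists k, `[< dB (walk J y k w) >]) with
  | left ex_hit => Some (ex_minn ex_hit)
  | right _ => None
  end.

Definition hit_prob (J : nat -> Omega -> int * int) (y : state) : \bar R :=
  P [set w | tau J y w <> None].

(* In the next two definitions the integrands are measurable as soon as the
   increments are, and an integral with a finite value has finite positive and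
   negative parts, so the equations include integrability. *)
Definition Y_harmonic (J : nat -> Omega -> int * int) (h : state -> R)
    : Prop :=
  forall y, ('E_P[fun w => h (walk J y 1 w)] = (h y)%:E)%E.

(* Only the values of g on dB matter, since the walk is in dB at time tau. *)
Definition dB_determined (J : nat -> Omega -> int * int) (h : state -> R)
    : Prop :=
  exists g : state -> R, forall y, B y ->
    ((h y)%:E =
     'E_P[fun w => if tau J y w is Some k then g (walk J y k w) else 0%R])%E.

End Walk.

Section Functions.
Variable R : realType.
Implicit Types (a b : R[i]) (y : state).

Definition bracket b a y : R[i] := b ^ (y.1 - y.2%:Z) * a ^+ y.2.

Definition Ccoef b a : R[i] := 1 - b / a.

Definition rho (lam mu : R) : R := lam / mu.

Definition rtot (lam1 lam2 mu1 mu2 : R) : R := (lam1 + lam2) / (mu1 + mu2).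

Definition alphaC (lam2 mu2 : R) b a : R[i] :=
  b ^+ 2 / (a * (rho lam2 mu2)%:C).

(* sqrtc is the principal square root: Re (sqrtc z) >= 0, and
   sqrtc (- x) = i sqrt x for real x > 0. *)
Definition beta1 (lam1 lam2 mu1 mu2 : R) a : R[i] :=
  let q := mu2%:C / a + mu1%:C in
  let p := lam1%:C + lam2%:C * a in
  let Delta := 1 - 4 * q * p in
  if q == 0 then p else (1 - sqrtc Delta) / (2 * q).

Definition h_beta1 (lam1 lam2 mu1 mu2 : R) a y : R[i] :=
  let b := beta1 lam1 lam2 mu1 mu2 a in
  let a' := alphaC lam2 mu2 b a in
  Ccoef b a' * bracket b a y - Ccoef b a * bracket b a' y.

Definition h_beta1_defined (lam1 lam2 mu1 mu2 : R) a : Prop :=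
  let b := beta1 lam1 lam2 mu1 mu2 a in
  b != 0 /\ a != alphaC lam2 mu2 b a.

Definition h_r (lam1 lam2 mu1 mu2 : R) y : R[i] :=
  let r := rtot lam1 lam2 mu1 mu2 in
  let rho2 := rho lam2 mu2 in
  bracket r%:C 1 y
  - ((1 - r) / (1 - rho2 / r))%:C * bracket r%:C (r ^+ 2 / rho2)%:C y.

Definition h_rho1 (lam1 mu1 : R) y : R[i] :=
  bracket (rho lam1 mu1)%:C (rho lam1 mu1)%:C y.

Definition h_star (lam1 lam2 mu1 mu2 : R) (K : nat) (c0 : R[i])
    (c alpha : 'I_K -> R[i]) y : R[i] :=
  h_r lam1 lam2 mu1 mu2 y + c0 * h_rho1 lam1 mu1 y
  + \sum_(k < K) c k * h_beta1 lam1 lam2 mu1 mu2 (alpha k) y.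

Definition h_re (lam1 lam2 mu1 mu2 : R) (K : nat) (c0 : R[i])
    (c alpha : 'I_K -> R[i]) y : R :=
  complex.Re (h_star lam1 lam2 mu1 mu2 c0 c alpha y).

Definition c_star (h : state -> R[i]) : \bar R :=
  ereal_sup [set (cnorm (h y - 1))%:E | y in dB].

End Functions.

(* Main.v *)
(* h* is a combination of brackets [b, a], paired with a common b so that the
   boundary defects at y(2) = 0 cancel, and |h*(y)| <= C s^(y(1) - y(2)) on B for
   some s < 1.  Stopping the walk on dB splits h*(y) into the contribution of
   {tau <= n}, which tends to E_y[h*(Y_tau) 1_{tau < oo}] by dominated
   convergence, and that of {tau > n}.  The latter vanishes because, for z > 1
   and every m,
     s^(y(1) - y(2)) <= z^(y(2) - m) + s^(y(1) - m)   on B,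
   where E[s^(Y_n(1))] decays geometrically for s < 1 close to 1 (the first
   coordinate drifts to +oo) while E[z^(Y_n(2))] stays bounded for z > 1 close
   to 1.  The relative error comes from
     h*(y) - P_y(tau < oo) = E_y[(h*(Y_tau) - 1) 1_{tau < oo}],
   multiplied by the conjugate of its left side so that only real-valued
   functions are averaged. *)

Require Import Defs.
From mathcomp Require Import all_boot all_order all_algebra.
From mathcomp Require Import all_classical all_reals all_analysis.
From mathcomp Require Import complex.
From mathcomp Require Import measurable_realfun ring lra zify.

Set Implicit Arguments.
Unset Strict Implicit.
Unset Printing Implicit Defensive.

Import Order.TTheory GRing.Theory Num.Theory.
Import numFieldNormedType.Exports.

Local Open Scope classical_set_scope.
Local Open Scope ring_scope.
Local Open Scope complex_scope.

(** * Joint law of the first n increments, and expectations as iterated one-step averages *)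

Section FiniteDimensionalLaws.
Context d (Omega : measurableType d) (R : realType) (P : probability Omega R).
Variables (J : nat -> Omega -> int * int) (js : seq (int * int)).
Variable p : int * int -> R.
Hypothesis J_meas : measurable_increments J.
Hypothesis J_indep : mutually_independent P J.
Hypothesis js_uniq : uniq js.
Hypothesis J_law : forall k j, j \in js -> P (J k @^-1` [set j]) = (p j)%:E.
Hypothesis p_sum1 : \sum_(j <- js) p j = 1.

Fixpoint words (n : nat) : seq (seq (int * int)) :=
  if n is n'.+1 then [seq j :: s | j <- js, s <- words n'] else [:: [::]].

Definition wordw (s : seq (int * int)) : R := \prod_(j <- s) p j.

Definition incrs (n : nat) (w : Omega) : seq (int * int) :=
  mkseq (fun k => J k w) n.

Lemma words_uniq n : uniq (words n).
Proof.
by elim: n => //= n IH; apply: allpairs_uniq => // -[i s] [k t] _ _ [-> ->].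
Qed.

Lemma mem_words n s : s \in words n -> size s = n /\ all (mem js) s.
Proof.
elim: n s => [|n IH] s /=; first by rewrite inE => /eqP->.
by case/allpairsP => -[i t] /= [ij /IH[<- tj] ->] /=; rewrite ij.
Qed.

Lemma sum_words n (F : seq (int * int) -> R) :
  \sum_(s <- words n.+1) F s =
  \sum_(j <- js) \sum_(s <- words n) F (j :: s).
Proof. by rewrite /= big_allpairs_dep. Qed.

Lemma sum_wordw n : \sum_(s <- words n) wordw s = 1.
Proof.
elim: n => [|n IH]; first by rewrite big_seq1 /wordw big_nil.
rewrite sum_words -p_sum1; apply: eq_bigr => j _.
under eq_bigr do rewrite /wordw big_cons.
by rewrite -mulr_sumr IH mulr1.
Qed.

Lemma incrs_fiber n s : size s = n ->
  incrs n @^-1` [set s] =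
  \bigcap_(k in [set` iota 0 n]) (J k @^-1` [set nth 0 s k]).
Proof.
move=> sn; apply/seteqP; split => w /=.
  move=> <- k /=; rewrite mem_iota add0n => kn.
  by rewrite /incrs nth_mkseq.
move=> Hw; apply: (@eq_from_nth _ 0); rewrite size_mkseq ?sn // => k kn.
by rewrite nth_mkseq //; apply: Hw => /=; rewrite mem_iota add0n.
Qed.

(** There are countably many words, so the preimage is a countable union of fibers, each empty or a
    finite intersection of increment events. Hence every function of finitely many increments is
    measurable. *)
Lemma measurable_incrs n (A : set (seq (int * int))) :
  measurable (incrs n @^-1` A).
Proof.
have -> : incrs n @^-1` A =
    \bigcup_s (if s \in A then incrs n @^-1` [set s] else set0).
  apply/seteqP; split => w /=; last first.
    by case=> s _; case: ifP => // /set_mem As /= ->.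
  by move=> Aw; exists (incrs n w) => //; rewrite (mem_set Aw).
apply: countable_bigcupT_measurable => [|s]; first exact: countableP.
case: ifP => // _.
case: (eqVneq (size s) n) => [sn|sn].
  by rewrite incrs_fiber //; exact: fin_bigcap_measurable.
suff -> : incrs n @^-1` [set s] = set0 by [].
by apply/seteqP; split=> w //= ws; case/eqP: sn; rewrite -ws size_mkseq.
Qed.

Lemma incrs_law n s : s \in words n ->
  P (incrs n @^-1` [set s]) = (wordw s)%:E.
Proof.
case/mem_words => sn /allP sj; rewrite incrs_fiber //.
rewrite J_indep ?iota_uniq // /wordw [in RHS](big_nth 0) /index_iota sn subn0.
rewrite -prodEFin big_seq [RHS]big_seq; apply: eq_bigr => k.
rewrite mem_iota add0n => /andP[_ kn].
by rewrite J_law //; apply: sj; rewrite mem_nth // sn.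
Qed.

Lemma measurable_fun_incrs n (F : seq (int * int) -> R) :
  measurable_fun setT (fun w => F (incrs n w)).
Proof.
move=> _ A _; rewrite setTI.
exact: (measurable_incrs n (F @^-1` A)).
Qed.

(** Outside [words n] the increments may still take values, on a null set. Cutting [F] off there
    leaves a finite combination of indicators, which is integrated term by term. *)
Lemma integral_incrs_words n (F : seq (int * int) -> R) :
  (\int[P]_w (if incrs n w \in words n then F (incrs n w) else 0)%:E =
   (\sum_(s <- words n) wordw s * F s)%:E)%E.
Proof.
have mI s : measurable (incrs n @^-1` [set s]) by exact: measurable_incrs.
pose I s : Omega -> R := \1_(incrs n @^-1` [set s]).
have iI s : P.-integrable setT (fun w => (F s * I s w)%:E).
  under eq_fun do rewrite EFinM.
  by apply: integrableZl => //; apply: integrable_indic.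
have FI w : (if incrs n w \in words n then F (incrs n w) else 0) =
    \sum_(s <- words n) F s * I s w.
  case: ifPn => ww; last first.
    rewrite big_seq big1 // => s sw.
    rewrite /I indicE memNset ?mulr0 //= => e.
    by rewrite e sw in ww.
  rewrite (bigD1_seq _ ww) ?words_uniq //= big1 ?addr0.
    by rewrite /I indicE mem_set ?mulr1.
  move=> s sw; rewrite /I indicE memNset ?mulr0 //= => e.
  by rewrite e eqxx in sw.
under eq_integral do rewrite FI -sumEFin.
rewrite integral_sum // -sumEFin big_seq [RHS]big_seq.
apply: eq_bigr => s sw; under eq_integral do rewrite EFinM.
rewrite integralZl //; last exact: integrable_indic.
by rewrite integral_indic // setIT [X in (_ * X)%E](incrs_law sw) -EFinM mulrC.
Qed.

(** The word weights already sum to 1, so no mass is left for other values; the mass is computed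
    from the cut-off integral with [F] equal to 1. *)
Lemma incrs_words_ae n : {ae P, forall w, incrs n w \in words n}.
Proof.
have mW : measurable (incrs n @^-1` [set` words n]).
  exact: measurable_incrs.
have PW : P (incrs n @^-1` [set` words n]) = 1%E.
  have := integral_incrs_words n (fun=> 1).
  under [in RHS]eq_bigr do rewrite mulr1.
  rewrite sum_wordw => <-.
  rewrite -[X in P X]setIT -integral_indic //.
  apply: eq_integral => w _; rewrite indicE; congr _%:E.
  case: ifPn => ww; first by rewrite mem_set.
  by rewrite memNset //= => ww'; rewrite ww' in ww.
exists (~` (incrs n @^-1` [set` words n])); split => //.
  exact: measurableC.
by rewrite probability_setC // PW subee.
Qed.

Lemma expectation_incrs n (F : seq (int * int) -> R) :
  ('E_P[fun w => F (incrs n w)] = (\sum_(s <- words n) wordw s * F s)%:E)%E.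
Proof.
rewrite unlock -integral_incrs_words; apply: ae_eq_integral => //.
- exact/measurable_EFinP/measurable_fun_incrs.
- apply/measurable_EFinP.
  exact: (measurable_fun_incrs n (fun s => if s \in words n then F s else 0)).
- by apply: filterS (incrs_words_ae n) => w ww _; rewrite ww.
Qed.

(** The update [u] is left arbitrary so that the free walk and the walk frozen on the diagonal share
    one expectation formula. *)
Definition chain (S : Type) (u : S -> int * int -> S) (y : S) n w : S :=
  foldl u y (incrs n w).

Definition avg (S : Type) (u : S -> int * int -> S) (f : S -> R) (y : S) : R :=
  \sum_(j <- js) p j * f (u y j).

Lemma chainS (S : Type) (u : S -> int * int -> S) y n w :
  chain u y n.+1 w = u (chain u y n w) (J n w).
Proof. by rewrite /chain /incrs mkseqS foldl_rcons. Qed.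

(** Induction with the starting point generalised: the weight of a word is a product, so its first
    letter can be split off as the outermost average. *)
Lemma expectation_chain (S : Type) (u : S -> int * int -> S) f y n :
  ('E_P[fun w => f (chain u y n w)] = (iter n (avg u) f y)%:E)%E.
Proof.
rewrite (expectation_incrs n (f \o foldl u y)); congr _%:E.
elim: n y => [|n IH] y; first by rewrite big_seq1 /wordw big_nil mul1r.
rewrite sum_words iterS; apply: eq_bigr => j _; rewrite -IH mulr_sumr.
by apply: eq_bigr => s _; rewrite /wordw big_cons mulrA.
Qed.

End FiniteDimensionalLaws.

(** * Monotonicity, linearity and drift inequalities for iterated averages *)

Section AveragingOperator.
Context (R : realType) (js : seq (int * int)) (p : int * int -> R).
Context (S : Type) (u : S -> int * int -> S).
Hypothesis p_ge0 : forall j, 0 <= p j.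
Hypothesis p_sum1 : \sum_(j <- js) p j = 1.
Local Notation T := (avg js p u).
Implicit Types (f g : S -> R) (y : S).

Lemma iter_avg_le n f g y :
  (forall x, f x <= g x) -> iter n T f y <= iter n T g y.
Proof.
move=> fg; elim: n y => //= n IH y; apply: ler_sum => j _.
exact: ler_wpM2l.
Qed.

Lemma iter_avg_lin n a b f g y :
  iter n T (fun x => a * f x + b * g x) y =
  a * iter n T f y + b * iter n T g y.
Proof.
elim: n y => //= n IH y; rewrite /avg !mulr_sumr -big_split /=.
by apply: eq_bigr => j _; rewrite IH; ring.
Qed.

Lemma iter_avg_cst n a y : iter n T (fun=> a) y = a.
Proof.
elim: n y => //= n IH y; rewrite /avg.
under eq_bigr do rewrite IH.
by rewrite -mulr_suml p_sum1 mul1r.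
Qed.

Lemma iter_avg_harmonic n f y :
  (forall x, T f x = f x) -> iter n T f y = f y.
Proof.
move=> Tf; elim: n y => //= n IH y; rewrite -[RHS]Tf.
by apply: eq_bigr => j _; rewrite IH.
Qed.

Lemma iter_avg_norm n f g y :
  (forall x, `|f x| <= g x) -> `|iter n T f y| <= iter n T g y.
Proof.
move=> fg; rewrite ler_norml; apply/andP; split.
  have -> : - iter n T g y = iter n T (fun x => - 1 * g x + 0 * g x) y.
    by rewrite iter_avg_lin; ring.
  apply: iter_avg_le => x; move: (fg x); rewrite ler_norml => /andP[+ _].
  by rewrite mulN1r mul0r addr0.
by apply: iter_avg_le => x; apply: le_trans (fg x); exact: ler_norm.
Qed.

(** A Foster-Lyapunov drift condition, iterated: the map t -> th t + (1 - th) D fixes [D], so its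
    n-th power is explicit. *)
Lemma iter_avg_affine n th D f y : 0 <= th ->
  (forall x, T f x <= th * f x + (1 - th) * D) ->
  iter n T f y <= th ^+ n * f y + (1 - th ^+ n) * D.
Proof.
move=> th0 Tf; elim: n => [|n IH].
  by rewrite expr0 mul1r subrr mul0r addr0.
(* The drift inequality is applied innermost, under the monotone [iter n T]; linearity and
   invariance of constants then reach the induction hypothesis. *)
rewrite iterSr; apply: (@le_trans _ _ (th * iter n T f y + (1 - th) * D)).
  apply: le_trans (iter_avg_le n y Tf) _.
  by rewrite -[in leRHS](iter_avg_cst n D y) -iter_avg_lin.
by rewrite exprS; move: (ler_wpM2l th0 IH); lra.
Qed.

End AveragingOperator.

(** * The four jumps, and drift of each coordinate before absorption *)

Definition jumps : seq (int * int) := [:: (-1, 0); (1, 0); (0, 1); (0, -1)].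

Definition jump_weight (R : realType) (lam1 lam2 mu1 mu2 : R)
    (j : int * int) : R :=
  if j == (-1, 0) then lam1 else if j == (1, 0) then mu1
  else if j == (0, 1) then lam2 else mu2.

(** For [y] in [B], averaging [live f] over n steps of the walk stopped on the diagonal gives
    E_y[f(Y_n) 1_{tau > n}]. *)
Definition live (R : realType) (f : state -> R) (y : state) : R :=
  if y.2%:Z < y.1 then f y else 0.

(* On B the absorbing set [y.1 <= y.2] is the diagonal dB. *)
Definition stop_step (y : state) (j : int * int) : state :=
  if y.2%:Z < y.1 then step y j else y.

Section WalkOperator.
Context (R : realType) (lam1 lam2 mu1 mu2 : R).
Hypotheses (lam1_gt0 : 0 < lam1) (lam2_gt0 : 0 < lam2).
Hypotheses (mu1_gt0 : 0 < mu1) (mu2_gt0 : 0 < mu2).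
Hypothesis sum1 : lam1 + lam2 + mu1 + mu2 = 1.
Local Notation p := (jump_weight lam1 lam2 mu1 mu2).
Local Notation T := (avg jumps p stop_step).

Lemma jump_weight_ge0 j : 0 <= p j.
Proof. by rewrite /jump_weight; do !case: ifP => _; apply: ltW. Qed.

Lemma avg_jumps (S : Type) (u : S -> int * int -> S) (f : S -> R) y :
  avg jumps p u f y =
  lam1 * f (u y (-1, 0)) + mu1 * f (u y (1, 0)) +
  lam2 * f (u y (0, 1)) + mu2 * f (u y (0, -1)).
Proof.
by rewrite /avg /jumps !big_cons big_nil /jump_weight /= addr0 !addrA.
Qed.

Lemma jump_weight_sum1 : \sum_(j <- jumps) p j = 1.
Proof.
by rewrite /jumps !big_cons big_nil /jump_weight /= -sum1; ring.
Qed.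

(** Absorbed states stay absorbed, and for nonnegative [f] absorption only loses mass. Drift bounds
    for the free walk therefore carry over to [live f]. *)
Lemma avg_stop_step_live (f : state -> R) y : (forall x, 0 <= f x) ->
  T (live f) y <= live (avg jumps p step f) y.
Proof.
move=> f0; rewrite {2}/live; case: ifPn => ly.
  apply: ler_sum => j _; apply: ler_wpM2l; first exact: jump_weight_ge0.
  by rewrite /stop_step ly /live; case: ifP.
rewrite /avg big1_seq // => j _.
by rewrite /stop_step (negbTE ly) /live (negbTE ly) mulr0.
Qed.

Lemma step_left (a : int) (b : nat) : step (a, b) (-1, 0) = (a - 1, b).
Proof. by rewrite /step /= ?subn1 ?addr0 ?addn0 ?addn1. Qed.

Lemma step_right (a : int) (b : nat) : step (a, b) (1, 0) = (a + 1, b).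
Proof. by rewrite /step /= ?subn1 ?addr0 ?addn0 ?addn1. Qed.

Lemma step_up (a : int) (b : nat) : step (a, b) (0, 1) = (a, b.+1).
Proof. by rewrite /step /= ?subn1 ?addr0 ?addn0 ?addn1. Qed.

Lemma step_down (a : int) (b : nat) : step (a, b.+1) (0, -1) = (a, b).
Proof. by rewrite /step /= ?subn1 ?addr0 ?addn0 ?addn1. Qed.

Lemma step_down0 (a : int) : step (a, 0%N) (0, -1) = (a, 0%N).
Proof. by []. Qed.

(** The factor is lam1/s + mu1 s + lam2 + mu2, the mean of s^(J(1)), rewritten so that it is visibly
    below 1 for lam1/mu1 < s < 1. Blocked steps do not affect the first coordinate. *)
Lemma live_horizontal_decay s n y : 0 < s ->
  iter n T (live (fun x => s ^ x.1)) y <=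
  (1 - (1 - s) * (mu1 - lam1 / s)) ^+ n * live (fun x => s ^ x.1) y.
Proof.
move=> s0; set q := 1 - _.
have q0 : 0 <= q.
  have -> : q = lam1 / s + mu1 * s + lam2 + mu2.
    by rewrite /q -{1}sum1; field; rewrite gt_eqF.
  rewrite ltW // ltr_wpDr ?ltW // ltr_wpDr ?ltW //.
  by rewrite addr_gt0 ?divr_gt0 ?mulr_gt0.
(* The affine drift bound is used with [D = 0]. *)
rewrite -[leRHS]addr0 -[X in _ + X](mulr0 (1 - q ^+ n)).
apply: iter_avg_affine => // [||x];
  [exact: jump_weight_ge0|exact: jump_weight_sum1|].
rewrite mulr0 addr0.
apply: le_trans (avg_stop_step_live _ _) _ => [z|].
  by rewrite exprz_ge0 ?ltW.
rewrite /live; case: ifP => _; last by rewrite mulr0.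
case: x => a b; rewrite avg_jumps step_left step_right step_up /=.
have -> : (step (a, b) (0, -1)).1 = a.
  by case: b => [|b]; rewrite ?step_down.
rewrite !expfzDr ?gt_eqF // expr1z exprN1 /q -{1}sum1.
by rewrite le_eqVlt; apply/orP; left; apply/eqP; field; rewrite gt_eqF.
Qed.

(** Above level 0 the mean of z^(J(2)) is a factor [th < 1]; only the blocked step at level 0 spoils
    the contraction, by a bounded amount. *)
Lemma live_vertical_bounded z y : 1 < z -> lam2 * z < mu2 ->
  exists K : R, forall n, iter n T (live (fun x => z ^+ x.2)) y <= K.
Proof.
move=> z1 z2; have z0 : 0 < z by exact: lt_trans z1.
pose th : R := 1 - (z - 1) * (mu2 / z - lam2).
have thE : th = lam2 * z + mu2 / z + lam1 + mu1.
  by rewrite /th -{1}sum1; field; rewrite gt_eqF.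
have th0 : 0 <= th.
  rewrite thE ltW // ltr_wpDr ?ltW // ltr_wpDr ?ltW // addr_gt0 ?divr_gt0 //.
  exact: mulr_gt0.
have th1 : th < 1.
  by rewrite /th ltrBlDr ltrDl mulr_gt0 ?subr_gt0 // ltr_pdivlMr.
(* Chosen so that (1 - th) D = lam2 z + 1, which dominates the one-step average lam2 z + 1 - lam2
   from level 0. *)
pose D := (lam2 * z + 1) / (1 - th).
have DE : (1 - th) * D = lam2 * z + 1.
  by rewrite /D mulrC divfK // subr_eq0 gt_eqF.
have D0 : 0 <= D.
  by rewrite divr_ge0 ?subr_ge0 ?(ltW th1) // addr_ge0 // mulr_ge0 ?ltW.
exists (live (fun x => z ^+ x.2) y + D) => n.
apply: (@le_trans _ _ (th ^+ n * live (fun x => z ^+ x.2) y +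
    (1 - th ^+ n) * D)).
  apply: iter_avg_affine => // [||x];
    [exact: jump_weight_ge0|exact: jump_weight_sum1|].
  rewrite DE; apply: le_trans (avg_stop_step_live _ _) _ => [u|].
    by rewrite exprn_ge0 // ltW.
  rewrite /live; case: ifP => _; last first.
    by rewrite mulr0 add0r addr_ge0 // mulr_ge0 ?ltW.
  case: x => a [|b]; rewrite avg_jumps step_left step_right step_up.
    rewrite step_down0 /= expr0 expr1 !mulr1.
    have -> : lam1 + mu1 + lam2 * z + mu2 = lam2 * z + (1 - lam2).
      by rewrite -sum1; ring.
    apply: (@le_trans _ _ (lam2 * z + 1)); rewrite ?lerDr //.
    by rewrite lerD2l gerBl ltW.
  rewrite step_down /= thE; set t := z ^+ b.
  have t0 : 0 <= t by rewrite exprn_ge0 // ltW.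
  have -> : (lam2 * z + mu2 / z + lam1 + mu1) * z ^+ b.+1 =
            lam1 * z ^+ b.+1 + mu1 * z ^+ b.+1 + lam2 * z ^+ b.+2 + mu2 * t.
    by rewrite /t !exprS; field; rewrite gt_eqF.
  by rewrite lerDl addr_ge0 // mulr_ge0 ?ltW.
have t0 := exprn_ge0 n th0; have t1 : th ^+ n <= 1 by rewrite exprn_ile1 // ltW.
have l0 : 0 <= live (fun x => z ^+ x.2) y.
  by rewrite /live; case: ifP => // _; rewrite exprn_ge0 // ltW.
by apply: lerD; [rewrite ler_piMl|rewrite ler_piMl // gerBl].
Qed.

End WalkOperator.

(** * The contribution of paths not yet absorbed tends to 0 *)

Section Transience.
Context (R : realType) (lam1 lam2 mu1 mu2 : R).
Hypotheses (lam1_gt0 : 0 < lam1) (lam2_gt0 : 0 < lam2).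
Hypotheses (mu1_gt0 : 0 < mu1) (mu2_gt0 : 0 < mu2).
Hypothesis sum1 : lam1 + lam2 + mu1 + mu2 = 1.
Hypotheses (lt1 : lam1 < mu1) (lt2 : lam2 < mu2).
Local Notation p := (jump_weight lam1 lam2 mu1 mu2).
Local Notation T := (avg jumps p stop_step).

(** The bound below has a term free of n that is small for large [m], and a term that decays in n
    once [m] is fixed; so [m] is chosen first. *)
Lemma live_vanish (h : state -> R) (C s : R) y : 0 <= s -> s < 1 ->
  (forall x, B x -> `|h x| <= C * s ^+ `|x.1 - x.2%:Z|%N) ->
  iter n T (live h) y @[n --> \oo] --> (0 : R).
Proof.
move=> s0 s1 hC.
have C0 : 0 <= C.
  by have := hC (0, 0%N) (lexx _); rewrite expr0 mulr1; apply: le_trans.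
(* At least [s], to dominate the decay of [h], and strictly between lam1/mu1 and 1, to make the
   horizontal factor [q] less than 1. *)
pose t : R := Num.max s ((1 + lam1 / mu1) / 2).
have r1 : lam1 / mu1 < 1 by rewrite ltr_pdivrMr // mul1r.
have t1 : t < 1 by rewrite gt_max s1 /=; lra.
have tr : lam1 / mu1 < t by rewrite lt_max; apply/orP; right; lra.
have t0 : 0 < t by apply: lt_trans tr; exact: divr_gt0.
have st : s <= t by rewrite le_max lexx.
(* The midpoint of 1 and mu2/lam2 lies in the range where the vertical moment stays bounded. *)
pose z : R := (1 + mu2 / lam2) / 2.
have r2 : 1 < mu2 / lam2 by rewrite ltr_pdivlMr // mul1r.
have z1 : 1 < z by rewrite /z; lra.
have z2 : lam2 * z < mu2 by rewrite mulrC -ltr_pdivlMr // /z; lra.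
have z0 : 0 < z by exact: lt_trans z1.
pose q : R := 1 - (1 - t) * (mu1 - lam1 / t).
have q1 : q < 1.
  rewrite /q ltrBlDr ltrDl mulr_gt0 ?subr_gt0 //.
  by rewrite ltr_pdivrMr // mulrC -ltr_pdivrMr.
have q0 : 0 <= q.
  have -> : q = lam1 / t + mu1 * t + lam2 + mu2.
    by rewrite /q -{1}sum1; field; rewrite gt_eqF.
  rewrite ltW // ltr_wpDr ?ltW // ltr_wpDr ?ltW //.
  by rewrite addr_gt0 ?divr_gt0 ?mulr_gt0.
have [K HK] :=
  live_vertical_bounded lam1_gt0 lam2_gt0 mu1_gt0 mu2_gt0 sum1 y z1 z2.
pose L := live (fun x => t ^ x.1) y.
have bound m n : `|iter n T (live h) y| <=
    C * K * z^-1 ^+ m + C * t ^- m * L * q ^+ n.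
  apply: (@le_trans _ _ (iter n T (fun x =>
     (C * z^-1 ^+ m) * live (fun x => z ^+ x.2) x +
     (C * t ^- m) * live (fun x => t ^ x.1) x) y)).
    apply: iter_avg_norm => [|x]; first exact: jump_weight_ge0.
    rewrite /live; case: ifPn => lx; last by rewrite normr0 !mulr0 addr0.
    apply: le_trans (hC _ (ltW lx)) _; rewrite -!mulrA -mulrDr.
    apply: ler_wpM2l => //.
    case: x lx => a b /= lx.
    have [k ak] : exists k : nat, a = b%:Z + k%:Z.
      exists `|a - b%:Z|%N.
      by rewrite gez0_abs ?subr_ge0 ?(ltW lx) // addrCA subrr addr0.
    rewrite {}ak {lx} addrC addKr absz_nat -PoszD -exprnP.
    apply: (@le_trans _ _ (t ^+ k)); first by rewrite lerXn2r // nnegrE ltW.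
    have zt : 0 <= z^-1 ^+ m * z ^+ b.
      by rewrite mulr_ge0 // exprn_ge0 ?invr_ge0 // ltW.
    have tt : 0 <= t ^- m * t ^+ (b + k).
      by rewrite mulr_ge0 ?invr_ge0 // exprn_ge0 // ltW.
    (* If m <= b, then t^k <= 1 <= z^(b - m). Otherwise t^(b - m) >= 1, so t^k is at most the
       horizontal term. *)
    case: (leqP m b) => mb.
      apply: (@le_trans _ _ 1); first by rewrite exprn_ile1 // ltW.
      apply: ler_wpDr => //; rewrite -(subnK mb) exprD exprVn mulrCA.
      by rewrite mulVf ?expf_neq0 ?gt_eqF // mulr1 exprn_ege1 // ltW.
    apply: ler_wpDl => //; rewrite exprD mulrA ler_peMl ?exprn_ge0 ?(ltW t0) //.
    rewrite -(subnK (ltnW mb)) exprD invfM -mulrA mulVf ?expf_neq0 ?gt_eqF //.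
    by rewrite mulr1 invf_ge1 ?exprn_gt0 // exprn_ile1 // ltW.
  rewrite iter_avg_lin; apply: lerD.
    rewrite [leRHS]mulrAC ler_wpM2l // mulr_ge0 // exprn_ge0 // invr_ge0 ltW //.
  rewrite -[leRHS]mulrA [L * _]mulrC; apply: ler_wpM2l.
    by rewrite mulr_ge0 // invr_ge0 exprn_ge0 // ltW.
  exact: live_horizontal_decay.
apply/cvgr0Pnorm_le => e e0.
have zV : `|z^-1| < 1.
  by rewrite normrV ?unitfE ?gt_eqF // gtr0_norm // invf_lt1.
have [m Hm] : exists m, `|C * K * z^-1 ^+ m| <= e / 2.
  have : (fun m => C * K * z^-1 ^+ m) @ \oo --> (0 : R).
    rewrite -[X in _ --> X](mulr0 (C * K)); apply: cvgMr.
    exact: cvg_expr.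
  move/cvgr0Pnorm_le => /(_ (e / 2)); rewrite divr_gt0 // => /(_ isT).
  by case=> N _ HN; exists N; apply: HN => /=.
have : (fun n => C * t ^- m * L * q ^+ n) @ \oo --> (0 : R).
  rewrite -[X in _ --> X](mulr0 (C * t ^- m * L)); apply: cvgMr.
  by apply: cvg_expr; rewrite ger0_norm.
move/cvgr0Pnorm_le => /(_ (e / 2)); rewrite divr_gt0 // => /(_ isT).
apply: filterS => n Hn; apply: le_trans (bound m n) _.
rewrite [e]splitr; apply: lerD; apply: le_trans (ler_norm _) _ => //.
Qed.

End Transience.

(** * The walk frozen on the diagonal, and the hitting time *)

Definition diag_step (y : state) (j : int * int) : state :=
  if y.1 == y.2%:Z then y else step y j.

Definition diag (R : realType) (g : state -> R) (y : state) : R :=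
  if y.1 == y.2%:Z then g y else 0.

(** A jump lowers y(1) - y(2) by at most 1, so the diagonal cannot be crossed without being hit. *)
Lemma stop_step_B y j : j \in jumps -> B y -> B (stop_step y j).
Proof.
case: y => a b; rewrite /B /stop_step /= !inE => ej ab; case: ifP => //= lab.
case/or4P: ej => /eqP->; rewrite ?step_left ?step_right ?step_up /=; try lia.
by case: b ab lab => [|b] ab lab; rewrite ?step_down ?step_down0 /=; lia.
Qed.

(** Links the two ways of stopping: [diag_step] agrees with the walk stopped at tau on every path
    and from every start, while [stop_step] suits the drift bounds. They coincide on [B], which the
    jumps preserve. *)
Lemma iter_avg_diag_step (R : realType) (p : int * int -> R) f g n y :
  (forall x, B x -> f x = g x) -> B y ->
  iter n (avg jumps p diag_step) f y = iter n (avg jumps p stop_step) g y.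
Proof.
move=> fg; elim: n y => [|n IH] y By; first exact: fg.
rewrite !iterS; apply: eq_big_seq => j jj.
have -> : diag_step y j = stop_step y j.
  rewrite /diag_step /stop_step; move: By; rewrite /B /= le_eqVlt eq_sym.
  by case: (eqVneq y.1 y.2%:Z) => [->|_ /= ->] //; rewrite ltxx.
by rewrite IH //; apply: stop_step_B.
Qed.

Section HittingTime.
Context d (Omega : measurableType d) (R : realType) (P : probability Omega R).
Context (lam1 lam2 mu1 mu2 : R) (J : nat -> Omega -> int * int).
Hypothesis sum1 : lam1 + lam2 + mu1 + mu2 = 1.
Hypothesis J_iid : iid_increments P lam1 lam2 mu1 mu2 J.
Local Notation p := (jump_weight lam1 lam2 mu1 mu2).

Lemma jumps_law k j : j \in jumps -> P (J k @^-1` [set j]) = (p j)%:E.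
Proof.
case: J_iid => _ _ /(_ k)[l1 m1 l2 m2]; rewrite !inE.
by case/or4P => /eqP-> //.
Qed.

Lemma expectation_chain_jumps (S : Type) (u : S -> int * int -> S) f y n :
  ('E_P[fun w => f (chain J u y n w)] = (iter n (avg jumps p u) f y)%:E)%E.
Proof.
case: J_iid => mJ iJ _; apply: expectation_chain => //.
- exact: jumps_law.
- exact: jump_weight_sum1.
Qed.

Lemma walk_harmonic (h : state -> R) :
  (forall y, avg jumps p step h y = h y) -> Y_harmonic P J h.
Proof.
by move=> hh y; rewrite -[in RHS]hh -(expectation_chain_jumps _ _ _ 1).
Qed.

Lemma chain_diag_before y n w : (forall i, (i < n)%N -> ~ dB (walk J y i w)) ->
  chain J diag_step y n w = walk J y n w.
Proof.
elim: n => // n IH nd; rewrite chainS IH => [|i ni]; last exact/nd/ltnW.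
by rewrite /diag_step; case: ifPn => // /eqP /(nd n (ltnSn n)).
Qed.

Lemma chain_diag_after y k n w : tau J y w = Some k -> (k <= n)%N ->
  dB (walk J y k w) /\ chain J diag_step y n w = walk J y k w.
Proof.
rewrite /tau; case: pselect => // exk [<-]; case: ex_minnP => m /asboolP dm mini.
move=> mn; split=> //; elim: n mn => [|n IH].
  by rewrite leqn0 => /eqP->.
rewrite leq_eqVlt => /predU1P[mn|/IH h].
  rewrite -mn; apply: chain_diag_before => i im di.
  by move: (mini i (asboolT di)); rewrite leqNgt im.
by rewrite chainS h /diag_step ifT //; apply/eqP.
Qed.

Lemma tau_none y w : tau J y w = None -> forall k, ~ dB (walk J y k w).
Proof.
rewrite /tau; case: pselect => // nex _ k dk.
by apply: nex; exists k; apply/asboolP.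
Qed.

Definition at_tau (g : state -> R) y w : R :=
  if tau J y w is Some k then g (walk J y k w) else 0.

(** The sequence is constant from time tau on, and identically 0 when tau is infinite. *)
Lemma diag_chain_cvg g y w :
  diag g (chain J diag_step y n w) @[n --> \oo] --> at_tau g y w.
Proof.
rewrite /at_tau; case E: (tau J y w) => [k|].
  apply: cvg_near_cst; exists k => // n /= kn.
  case: (chain_diag_after E kn) => dk ->.
  by rewrite /diag ifT //; apply/eqP.
apply: cvg_near_cst; exists 0%N => // n _ /=.
have nd := tau_none E; rewrite chain_diag_before /diag => [|i _]; last exact: nd.
by rewrite ifF //; apply/eqP; exact: nd.
Qed.

Lemma measurable_diag_chain (g : state -> R) y n :
  measurable_fun setT (fun w => diag g (chain J diag_step y n w)).
Proof.
case: J_iid => mJ _ _.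
exact: (measurable_fun_incrs mJ n (diag g \o foldl diag_step y)).
Qed.

(** A pointwise limit of functions of finitely many increments; measurability of the hitting event
    is deduced from this one. *)
Lemma measurable_at_tau g y : measurable_fun setT (at_tau g y).
Proof.
apply: (@measurable_fun_cvg _ _ _ _
  (fun n w => diag g (chain J diag_step y n w))).
  by move=> n; exact: measurable_diag_chain.
by move=> w _; exact: diag_chain_cvg.
Qed.

(** Dominated convergence with the constant [M]: a bound on [dB] suffices because [diag g] vanishes
    elsewhere. *)
Lemma expectation_at_tau_cvg (g : state -> R) (M : R) y :
  (forall x, dB x -> `|g x| <= M) ->
  (iter n (avg jumps p diag_step) (diag g) y)%:E @[n --> \oo] -->
  ('E_P[at_tau g y])%E.
Proof.
move=> gM; have M0 : 0 <= M by apply: le_trans (gM (0, 0%N) erefl).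
have -> : (fun n => (iter n (avg jumps p diag_step) (diag g) y)%:E) =
    (fun n => 'E_P[fun w => diag g (chain J diag_step y n w)])%E.
  by apply/funext => n; rewrite expectation_chain_jumps.
rewrite unlock; apply: (@dominated_cvg _ _ _ _ _ measurableT _ _ (fun=> M%:E)).
- by move=> n; apply/measurable_EFinP; exact: measurable_diag_chain.
- by move=> w _; apply: cvg_EFin; [exact: nearW|exact: diag_chain_cvg].
- by [].
- exact: finite_measure_integrable_cst.
- move=> n w _; rewrite lee_fin /diag; case: ifPn => [/eqP/gM//|_].
  by rewrite normr0.
Qed.

Lemma measurable_hit y : measurable [set w | tau J y w <> None].
Proof.
have -> : [set w | tau J y w <> None] = at_tau (fun=> 1) y @^-1` [set 1].
  apply/seteqP; split => w; rewrite /at_tau /=.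
    by case: (tau J y w) => [k|/(_ erefl)].
  by case: (tau J y w) => //= /esym/eqP; rewrite oner_eq0.
by rewrite -[X in measurable X]setTI; apply: measurable_at_tau.
Qed.

Lemma hit_probE y : hit_prob P J y = ('E_P[at_tau (fun=> 1%R) y])%E.
Proof.
rewrite -[LHS]expectation_indic; last exact: measurable_hit.
congr ('E_P[_])%E; apply/funext => w; rewrite indicE /at_tau.
case E: (tau J y w) => [k|]; first by rewrite mem_set //= E.
by rewrite memNset //= E; exact.
Qed.

Lemma hit_prob_fin_num y : hit_prob P J y \is a fin_num.
Proof. by apply: fin_num_measure; exact: measurable_hit. Qed.

End HittingTime.

(** * Optional stopping for harmonic functions decaying away from the diagonal *)

Definition decaying (R : realType) (h : state -> R[i]) : Prop :=
  exists C s : R, [/\ 0 <= s, s < 1 &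
    forall x, B x -> cnorm (h x) <= C * s ^+ `|x.1 - x.2%:Z|%N].

Definition step_harmonic (R : realType) (lam1 lam2 mu1 mu2 : R)
    (h : state -> R[i]) : Prop :=
  forall y, lam1%:C * h (step y (-1, 0)) + mu1%:C * h (step y (1, 0)) +
    lam2%:C * h (step y (0, 1)) + mu2%:C * h (step y (0, -1)) = h y.

Section OptionalStopping.
Context (R : realType) (lam1 lam2 mu1 mu2 : R).
Hypotheses (lam1_gt0 : 0 < lam1) (lam2_gt0 : 0 < lam2).
Hypotheses (mu1_gt0 : 0 < mu1) (mu2_gt0 : 0 < mu2).
Hypothesis sum1 : lam1 + lam2 + mu1 + mu2 = 1.
Hypotheses (lt1 : lam1 < mu1) (lt2 : lam2 < mu2).
Local Notation p := (jump_weight lam1 lam2 mu1 mu2).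

(** On [B], h = [diag h] + [live h]. The stopped averages of [h] equal [h], and those of [live h]
    vanish in the limit. *)
Lemma diag_iter_cvg (h : state -> R) (C s : R) y : 0 <= s -> s < 1 ->
  (forall x, B x -> `|h x| <= C * s ^+ `|x.1 - x.2%:Z|%N) ->
  (forall x, avg jumps p step h x = h x) -> B y ->
  iter n (avg jumps p diag_step) (diag h) y @[n --> \oo] --> h y.
Proof.
move=> s0 s1 hC hh By.
have -> : (fun n => iter n (avg jumps p diag_step) (diag h) y) =
    (fun n => h y - iter n (avg jumps p stop_step) (live h) y).
  apply/funext => n.
  rewrite (@iter_avg_diag_step _ _ _ (fun x => 1 * h x + (- 1) * live h x)) //.
    rewrite iter_avg_lin mul1r mulN1r; congr (_ - _).
    (* Harmonicity survives stopping: live states average as for [step], frozen ones trivially. *)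
    apply: iter_avg_harmonic => x; rewrite -[RHS]hh /avg.
    case: (boolP (x.2%:Z < x.1)) => lx.
      by apply: eq_bigr => j _; rewrite /stop_step lx.
    rewrite -/(avg jumps p step h x) hh.
    under eq_bigr do rewrite /stop_step (negbTE lx).
    by rewrite -mulr_suml (jump_weight_sum1 sum1) mul1r.
  move=> x; rewrite /B /diag /live /= le_eqVlt eq_sym mul1r mulN1r.
  case: (eqVneq x.1 x.2%:Z) => [->|_ /= ->]; rewrite ?ltxx ?subr0 //.
  by rewrite subrr.
rewrite -[X in _ --> X]subr0; apply: cvgB; first exact: cvg_cst.
exact: live_vanish hC.
Qed.

(** Multiplication by [v] and the real part are real-linear. The factor [v] is later 1, or the
    conjugate of the error. *)
Lemma step_harmonic_Re (h : state -> R[i]) v y :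
  step_harmonic lam1 lam2 mu1 mu2 h ->
  avg jumps p step (fun x => complex.Re (v * h x)) y = complex.Re (v * h y).
Proof.
move=> hh; rewrite avg_jumps -[in RHS]hh.
move: (h _) (h _) (h _) (h _) v => [a1 b1] [a2 b2] [a3 b3] [a4 b4] [x y'] /=.
ring.
Qed.

End OptionalStopping.

(** * Real parts and moduli of complex numbers *)

Lemma ler_norm_Re (R : realType) (z : R[i]) : `|complex.Re z| <= cnorm z.
Proof.
by case: z => a b /=; rewrite -sqrtr_sqr ler_wsqrtr // lerDl sqr_ge0.
Qed.

Lemma Re_mulBr (R : realType) (a b : R[i]) (t : R) :
  complex.Re (a * b) - complex.Re a * t = complex.Re (a * (b - t%:C)).
Proof. by case: a b => [a1 a2] [b1 b2] /=; ring. Qed.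

Lemma Re_conj_mul (R : realType) (z : R[i]) :
  complex.Re (conjc z * z) = cnorm z ^+ 2.
Proof. by case: z => a b /=; rewrite sqr_sqrtr ?addr_ge0 ?sqr_ge0 //; ring. Qed.

Lemma cnorm_conj (R : realType) (z : R[i]) : cnorm (conjc z) = cnorm z.
Proof. by case: z => a b /=; rewrite sqrrN. Qed.

Lemma cnorm_ge0 (R : realType) (z : R[i]) : 0 <= cnorm z.
Proof. by case: z => a b; exact: sqrtr_ge0. Qed.

Lemma cnorm_real (R : realType) (a : R) : cnorm a%:C = `|a|.
Proof. by rewrite /= expr0n addr0 sqrtr_sqr. Qed.

Lemma cnormD (R : realType) (x y : R[i]) : cnorm (x + y) <= cnorm x + cnorm y.
Proof. exact: le_normcD. Qed.

Lemma cnormN (R : realType) (x : R[i]) : cnorm (- x) = cnorm x.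
Proof. exact: normcN. Qed.

Lemma dB_B y : dB y -> B y.
Proof. by rewrite /dB /B /= => ->. Qed.

Lemma decaying_bounded (R : realType) (h : state -> R[i]) : decaying h ->
  exists C : R, forall x, B x -> cnorm (h x) <= C.
Proof.
case=> C [s [s0 s1 hC]]; exists C => x Bx; apply: le_trans (hC x Bx) _.
have C0 : 0 <= C.
  have := hC (0, 0%N) (lexx _); rewrite expr0 mulr1.
  by apply: le_trans; exact: cnorm_ge0.
by rewrite ler_piMr // exprn_ile1 // ltW.
Qed.

(** * Harmonicity, determination by the boundary, and the relative error *)

Section RelativeError.
Context (R : realType) (lam1 lam2 mu1 mu2 : R).
Hypotheses (lam1_gt0 : 0 < lam1) (lam2_gt0 : 0 < lam2).
Hypotheses (mu1_gt0 : 0 < mu1) (mu2_gt0 : 0 < mu2).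
Hypothesis sum1 : lam1 + lam2 + mu1 + mu2 = 1.
Hypotheses (lt1 : lam1 < mu1) (lt2 : lam2 < mu2).
Context d (Omega : measurableType d) (P : probability Omega R).
Context (J : nat -> Omega -> int * int).
Hypothesis J_iid : iid_increments P lam1 lam2 mu1 mu2 J.
Variable h : state -> R[i].
Hypotheses (h_harm : step_harmonic lam1 lam2 mu1 mu2 h) (h_decay : decaying h).
Local Notation p := (jump_weight lam1 lam2 mu1 mu2).
Local Notation T := (avg jumps p diag_step).

Lemma diag_Re_cvg v y : B y ->
  iter n T (diag (fun x => complex.Re (v * h x))) y @[n --> \oo] -->
  complex.Re (v * h y).
Proof.
move=> By; have [C [s [s0 s1 hC]]] := h_decay.
apply: (@diag_iter_cvg R lam1 lam2 mu1 mu2 _ _ _ _ _ _ _ _ (cnorm v * C) s)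
  => //.
  move=> x Bx; apply: le_trans (ler_norm_Re _) _.
  rewrite ComplexField.Normc.normcM -mulrA ler_wpM2l ?cnorm_ge0 //; exact: hC.
by move=> x; exact: step_harmonic_Re.
Qed.

Lemma Re_Y_harmonic : Y_harmonic P J (fun y => complex.Re (h y)).
Proof.
apply: (walk_harmonic sum1 J_iid) => y.
have := step_harmonic_Re 1 y h_harm.
by under eq_fun do rewrite mul1r; rewrite mul1r.
Qed.

Lemma Re_dB_determined : dB_determined P J (fun y => complex.Re (h y)).
Proof.
exists (fun y => complex.Re (h y)) => y By.
have [C hC] := decaying_bounded h_decay.
have lim : (iter n T (diag (fun x => complex.Re (h x))) y)%:E @[n --> \oo]
    --> (complex.Re (h y))%:E.
  apply: cvg_EFin; first exact: nearW.
  have := @diag_Re_cvg 1 y By; rewrite mul1r.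
  have -> // : (fun x => complex.Re (1 * h x)) = (fun x => complex.Re (h x)).
  by apply/funext => x; rewrite mul1r.
pose g x := complex.Re (h x).
have lim' : (iter n T (diag g) y)%:E @[n --> \oo] --> ('E_P[at_tau J g y])%E.
  apply: (@expectation_at_tau_cvg _ _ _ _ _ _ _ _ J sum1 J_iid _ C).
  move=> x /dB_B /hC.
  by apply: le_trans (ler_norm_Re _).
exact: (cvg_unique _ lim lim').
Qed.

Lemma c_star_lty : (c_star h < +oo)%E.
Proof.
have [C hC] := decaying_bounded h_decay.
apply: (@le_lt_trans _ _ (C + 1)%:E); last exact: ltry.
apply: ge_ereal_sup => _ [y /dB_B /hC hy <-].
rewrite lee_fin; apply: le_trans (cnormD _ _) _.
by rewrite lerD // cnormN ComplexField.Normc.normc1.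
Qed.

Lemma hit_prob_cvg y :
  iter n T (diag (fun=> 1)) y @[n --> \oo] --> fine (hit_prob P J y).
Proof.
have H : (iter n T (diag (fun=> 1)) y)%:E @[n --> \oo] -->
    (fine (hit_prob P J y))%:E.
  rewrite fineK; last exact: (hit_prob_fin_num J_iid).
  rewrite (hit_probE J_iid).
  apply: (@expectation_at_tau_cvg _ _ _ _ _ _ _ _ J sum1 J_iid _ 1) => x _.
  by rewrite normr1.
exact: (fine_cvg H).
Qed.

Lemma relative_error y : B y ->
  ((cnorm (h y - (fine (hit_prob P J y))%:C))%:E
   <= c_star h * hit_prob P J y)%E.
Proof.
move=> By; set p0 := fine _.
have p0E : hit_prob P J y = p0%:E.
  by rewrite fineK //; exact: (hit_prob_fin_num J_iid).
(* The point (0, 0) of [dB] gives the lower bound 0, which rules out -oo. *)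
have cfin : c_star h \is a fin_num.
  rewrite ge0_fin_numE ?c_star_lty //.
  apply: le_trans (ereal_sup_ubound _); last by exists (0, 0%N).
  by rewrite lee_fin cnorm_ge0.
pose M := fine (c_star h).
have hM x : dB x -> cnorm (h x - 1) <= M.
  move=> dx; rewrite -lee_fin fineK //; apply: ereal_sup_ubound; by exists x.
rewrite p0E -(fineK cfin) -EFinM lee_fin -/M.
set z := h y - _; set v := conjc z.
have p0_ge0 : 0 <= p0 by rewrite fine_ge0.
have M0 : 0 <= M by apply: le_trans (hM (0, 0%N) erefl); exact: cnorm_ge0.
(* Both sides are limits of n-step averages of functions carried by the diagonal, where Re(v (h -
   1)) <= |z| M holds pointwise. *)
have key : complex.Re (v * h y) - complex.Re v * p0 <= cnorm z * M * p0.
  have hp := @hit_prob_cvg y.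
  have hG := @diag_Re_cvg v y By.
  have lim1 : iter n T (diag (fun x => complex.Re (v * h x))) y -
      complex.Re v * iter n T (diag (fun=> 1)) y @[n --> \oo] -->
      complex.Re (v * h y) - complex.Re v * p0.
    by apply: cvgB; [exact: hG | exact: cvgMr].
  have lim2 : cnorm z * M * iter n T (diag (fun=> 1)) y @[n --> \oo] -->
      cnorm z * M * p0 by exact: cvgMr.
  apply: (ler_cvg_to lim1 lim2).
  apply: nearW => n.
  have -> : iter n T (diag (fun x => complex.Re (v * h x))) y -
      complex.Re v * iter n T (diag (fun=> 1)) y =
      iter n T (fun x => 1 * diag (fun x => complex.Re (v * h x)) x +
                 (- complex.Re v) * diag (fun=> 1) x) y.
    by rewrite iter_avg_lin mul1r mulNr.
  have -> : cnorm z * M * iter n T (diag (fun=> 1)) y =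
      iter n T (fun x => (cnorm z * M) * diag (fun=> 1) x + 0 * diag (fun=> 1) x) y.
    by rewrite iter_avg_lin mul0r addr0.
  apply: iter_avg_le => [|x]; first exact: jump_weight_ge0.
  rewrite /diag mul0r addr0 mul1r; case: eqP => dx; last by rewrite !mulr0 addr0.
  rewrite mulNr Re_mulBr mulr1.
  apply: le_trans (ler_norm _) _; apply: le_trans (ler_norm_Re _) _.
  rewrite ComplexField.Normc.normcM cnorm_conj.
  by rewrite ler_wpM2l ?cnorm_ge0 //; exact: hM.
have e : complex.Re (v * h y) - complex.Re v * p0 = cnorm z ^+ 2.
  by rewrite Re_mulBr Re_conj_mul.
move: key; rewrite e expr2 -mulrA.
(* The inequality |z|^2 <= |z| M p0 is divided by |z|, with |z| = 0 treated apart. *)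
have := cnorm_ge0 z; rewrite le_eqVlt => /predU1P[<- _|z0].
  exact: mulr_ge0.
by rewrite ler_pM2l.
Qed.

End RelativeError.

(** * Decay of brackets and of their linear combinations *)

Lemma cnormX (R : realType) (b : R[i]) n : cnorm (b ^+ n) = cnorm b ^+ n.
Proof.
elim: n => [|n IH]; first by rewrite !expr0 ComplexField.Normc.normc1.
by rewrite !exprS ComplexField.Normc.normcM IH.
Qed.

(** The rate is |b|, and |a|^(y(2)) <= 1. Equality |a| = 1 is allowed because [h_r] contains the
    bracket with a = 1. *)
Lemma decaying_bracket (R : realType) (b a : R[i]) :
  cnorm b < 1 -> cnorm a <= 1 -> decaying (bracket b a).
Proof.
move=> b1 a1; exists 1, (cnorm b); split => //; first exact: cnorm_ge0.
move=> [k n]; rewrite /B /bracket /= => kn.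
have -> : k - n%:Z = `|k - n%:Z|%N%:Z by rewrite gez0_abs ?subr_ge0.
rewrite absz_nat -exprnP ComplexField.Normc.normcM !cnormX mulrC.
by rewrite ler_wpM2r ?exprn_ge0 ?exprn_ile1 ?cnorm_ge0.
Qed.

Lemma decayingD (R : realType) (f g : state -> R[i]) :
  decaying f -> decaying g -> decaying (fun y => f y + g y).
Proof.
case=> [C [s [s0 s1 hC]]] [D [t [t0 t1 hD]]].
have ge0 (E u : R) (h : state -> R[i]) :
    (forall x, B x -> cnorm (h x) <= E * u ^+ `|x.1 - x.2%:Z|%N) -> 0 <= E.
  move=> /(_ (0, 0%N) (lexx _)); rewrite expr0 mulr1.
  by apply: le_trans; exact: cnorm_ge0.
exists (C + D), (Num.max s t); split; first by rewrite le_max s0.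
  by rewrite gt_max s1.
move=> x Bx; apply: le_trans (cnormD _ _) _; rewrite mulrDl; apply: lerD.
  apply: le_trans (hC x Bx) _; rewrite ler_wpM2l ?(ge0 _ _ _ hC) //.
  by rewrite lerXn2r ?nnegrE ?le_max ?s0 ?lexx.
apply: le_trans (hD x Bx) _; rewrite ler_wpM2l ?(ge0 _ _ _ hD) //.
by rewrite lerXn2r ?nnegrE ?le_max ?t0 ?lexx ?orbT.
Qed.

Lemma decayingZ (R : realType) (c : R[i]) (f : state -> R[i]) :
  decaying f -> decaying (fun y => c * f y).
Proof.
case=> [C [s [s0 s1 hC]]]; exists (cnorm c * C), s; split => // x Bx.
by rewrite ComplexField.Normc.normcM -mulrA ler_wpM2l ?cnorm_ge0 // hC.
Qed.

Lemma decaying_sum (R : realType) (I : Type) (s : seq I)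
    (F : I -> state -> R[i]) :
  (forall i, decaying (F i)) -> decaying (fun y => \sum_(i <- s) F i y).
Proof.
move=> hF; elim: s => [|i s IH].
  exists 0, 0; split=> // x _.
  by rewrite big_nil ComplexField.Normc.normc0 mul0r.
under eq_fun do rewrite big_cons.
exact: decayingD.
Qed.

(** * Harmonic functions from points of the characteristic curve *)

Section Harmonic.
Context (R : realType) (lam1 lam2 mu1 mu2 : R).
Local Notation harmonic := (step_harmonic lam1 lam2 mu1 mu2).

Lemma step_harmonicD f g :
  harmonic f -> harmonic g -> harmonic (fun y => f y + g y).
Proof. by move=> hf hg y; rewrite -[in RHS]hf -[in RHS]hg; ring. Qed.

Lemma step_harmonicZ c f : harmonic f -> harmonic (fun y => c * f y).
Proof. by move=> hf y; rewrite -[in RHS]hf; ring. Qed.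

Lemma step_harmonic_sum (I : Type) (s : seq I) (F : I -> state -> R[i]) :
  (forall i, harmonic (F i)) -> harmonic (fun y => \sum_(i <- s) F i y).
Proof.
move=> hF; elim: s => [|i s IH]; first by move=> y; rewrite !big_nil; ring.
by move=> y; rewrite !big_cons; exact: (step_harmonicD (hF i) IH y).
Qed.

(** The interior condition lam1/b + mu1 b + lam2 a/b + mu2 b/a = 1 multiplied by b, a quadratic in b
    of which [beta1] is a root. *)
Definition on_curve (b a : R[i]) : Prop :=
  lam1%:C + lam2%:C * a + (mu2%:C / a + mu1%:C) * b ^+ 2 = b.

(** At level 0 the blocked downward step contributes mu2 b^k where the interior equation has mu2 b^k
    (b/a); the difference is the defect. *)
Lemma bracket_step b a y : b != 0 -> a != 0 -> on_curve b a ->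
  lam1%:C * bracket b a (step y (-1, 0)) +
  mu1%:C * bracket b a (step y (1, 0)) +
  lam2%:C * bracket b a (step y (0, 1)) +
  mu2%:C * bracket b a (step y (0, -1)) =
  bracket b a y + (if y.2 is 0%N then mu2%:C * Ccoef b a * b ^ y.1 else 0).
Proof.
move=> b0 a0 cur.
(* The downward term is isolated, being the only one that changes at level 0. *)
have cur' : lam1%:C / b + mu1%:C * b + lam2%:C * a / b = 1 - mu2%:C * b / a.
  apply: (mulfI b0); rewrite mulrBr mulr1 -[X in _ = X - _]cur.
  by field; rewrite b0 a0.
have shift k (e : int) : b ^ (k + e) = b ^ k * b ^ e by exact: expfzDr.
have b1 k : b ^ (k + 1) = b ^ k * b by rewrite shift expr1z.
have bV k : b ^ (k - 1) = b ^ k / b by rewrite shift exprN1.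
case: y => k [|n]; rewrite step_left step_right step_up /bracket /Ccoef.
  rewrite step_down0 /= !subr0 expr0 expr1 b1 !bV.
  transitivity (b ^ k * (lam1%:C / b + mu1%:C * b + lam2%:C * a / b) +
    mu2%:C * b ^ k).
    by ring.
  by rewrite cur'; ring.
rewrite step_down /= addr0.
set e := b ^ (k - n.+1%:Z).
have -> : k - 1 - n.+1%:Z = k - n.+1%:Z - 1 by rewrite addrAC.
have -> : k + 1 - n.+1%:Z = k - n.+1%:Z + 1 by rewrite addrAC.
have -> : k - n.+2%:Z = k - n.+1%:Z - 1 by lia.
have -> : k - n%:Z = k - n.+1%:Z + 1 by lia.
rewrite b1 !bV -/e !exprS.
transitivity (e * (a * a ^+ n) * (lam1%:C / b + mu1%:C * b + lam2%:C * a / b) +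
   mu2%:C * (e * b * a ^+ n)); first by ring.
by rewrite cur'; field.
Qed.

(** With a common [b], both defects are multiples of the same b^(y(1)), so one linear relation
    cancels them. *)
Lemma bracket_pair_harmonic b a a' c c' : b != 0 -> a != 0 -> a' != 0 ->
  on_curve b a -> on_curve b a' -> c * Ccoef b a + c' * Ccoef b a' = 0 ->
  harmonic (fun y => c * bracket b a y + c' * bracket b a' y).
Proof.
move=> b0 a0 a'0 cur cur' cc y.
transitivity (
  c * (bracket b a y +
       (if y.2 is 0%N then mu2%:C * Ccoef b a * b ^ y.1 else 0)) +
  c' * (bracket b a' y +
        (if y.2 is 0%N then mu2%:C * Ccoef b a' * b ^ y.1 else 0))).
  by rewrite -!bracket_step //; ring.
case: y => k [|n] /=; last by ring.
transitivity (c * bracket b a (k, 0%N) + c' * bracket b a' (k, 0%N) +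
   (c * Ccoef b a + c' * Ccoef b a') * mu2%:C * b ^ k); first by ring.
by rewrite cc !mul0r addr0.
Qed.

(** The quadratic formula for q b^2 - b + l = 0, which degenerates to b = l when q = 0. *)
Lemma on_curve_beta1 a : on_curve (beta1 lam1 lam2 mu1 mu2 a) a.
Proof.
rewrite /on_curve /beta1; set q := _ / a + _; set l := _ + _ * a.
case: eqP => [->|/eqP q0]; first by rewrite mul0r addr0.
set r := sqrtc _; have r2 : r ^+ 2 = 1 - 4 * q * l by rewrite sqr_sqrtc.
have q2 : (2 : R[i]) * q != 0 by rewrite mulf_neq0 // pnatr_eq0.
(* After multiplication by 2q the two sides differ by (r^2 - Delta)/2. *)
apply: (mulfI q2); apply/eqP; rewrite -subr_eq0; apply/eqP.
transitivity ((r ^+ 2 - (1 - 4 * q * l)) / 2); last by rewrite r2 subrr mul0r.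
by field.
Qed.

Hypotheses (lam2_gt0 : 0 < lam2) (mu2_gt0 : 0 < mu2).

Lemma alphaC_neq0 b a : b != 0 -> a != 0 -> alphaC lam2 mu2 b a != 0.
Proof.
move=> b0 a0; rewrite /alphaC mulf_neq0 ?expf_neq0 // invr_eq0 mulf_neq0 //.
by rewrite (inj_eq (@complexI R)) /rho gt_eqF // divr_gt0.
Qed.

(* [a] and [alphaC b a] are the two roots in [a] of the curve equation, so
   their product is [mu2 b^2 / lam2]. *)
Lemma on_curve_alphaC b a : b != 0 -> a != 0 ->
  on_curve b a -> on_curve b (alphaC lam2 mu2 b a).
Proof.
move=> b0 a0; rewrite /on_curve => cur; rewrite -[RHS]cur.
have l0 : lam2%:C != 0 by rewrite (inj_eq (@complexI R)) gt_eqF.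
have m0 : mu2%:C != 0 by rewrite (inj_eq (@complexI R)) gt_eqF.
rewrite /alphaC /rho rmorphM /= fmorphV /=; field.
by rewrite l0 m0 a0 b0.
Qed.

Lemma h_beta1_harmonic a : a != 0 -> h_beta1_defined lam1 lam2 mu1 mu2 a ->
  harmonic (h_beta1 lam1 lam2 mu1 mu2 a).
Proof.
move=> a0 [b0 _]; rewrite /h_beta1.
set b := beta1 _ _ _ _ _ in b0 *; set a' := alphaC _ _ _ _.
have cur := on_curve_beta1 a; rewrite -/b in cur.
have := @bracket_pair_harmonic b a a' (Ccoef b a') (- Ccoef b a) b0 a0
  (alphaC_neq0 b0 a0) cur (on_curve_alphaC b0 a0 cur).
rewrite mulNr [X in _ - X]mulrC subrr => /(_ erefl) h y.
by have := h y; rewrite !mulNr.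
Qed.

Hypotheses (lam1_gt0 : 0 < lam1) (mu1_gt0 : 0 < mu1).
Hypothesis sum1 : lam1 + lam2 + mu1 + mu2 = 1.

(** Since C(rho1, rho1) = 0 there is no boundary defect, and one bracket suffices: the pair lemma is
    used with second coefficient 0. *)
Lemma h_rho1_harmonic : harmonic (h_rho1 lam1 mu1).
Proof.
have m0 : mu1%:C != 0 :> R[i] by rewrite (inj_eq (@complexI R)) gt_eqF.
have l0 : lam1%:C != 0 :> R[i] by rewrite (inj_eq (@complexI R)) gt_eqF.
have s1 : lam1%:C + lam2%:C + mu1%:C + mu2%:C = 1 :> R[i].
  by rewrite -!rmorphD sum1.
have rE : (rho lam1 mu1)%:C = lam1%:C / mu1%:C by rewrite /rho rmorphM fmorphV.
have r0 : (rho lam1 mu1)%:C != 0 by rewrite rE mulf_neq0 ?invr_eq0.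
have cur : on_curve (rho lam1 mu1)%:C (rho lam1 mu1)%:C.
  rewrite /on_curve rE -[RHS]mul1r -s1; field.
  by rewrite l0 m0.
have H := @bracket_pair_harmonic _ _ _ 1 0 r0 r0 r0 cur cur.
move=> y; have := H _ y; rewrite /Ccoef divff // subrr !mulr0 addr0 => /(_ erefl).
by rewrite !mul1r !mul0r !addr0.
Qed.

(** The point (r, 1) is on the curve and (r, r^2/rho2) is its conjugate. The coefficient is C(r,
    1)/C(r, r^2/rho2), whose denominator is nonzero because r differs from rho2. *)
Lemma h_r_harmonic : rtot lam1 lam2 mu1 mu2 != rho lam2 mu2 ->
  harmonic (h_r lam1 lam2 mu1 mu2).
Proof.
move=> rr; rewrite /h_r; set r := rtot _ _ _ _ in rr *; set r2 := rho _ _ in rr *.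
have r_gt0 : 0 < r by rewrite divr_gt0 ?addr_gt0.
have r2_gt0 : 0 < r2 by rewrite divr_gt0.
have r0 : r%:C != 0 by rewrite (inj_eq (@complexI R)) gt_eqF.
have a'E : (r ^+ 2 / r2)%:C = alphaC lam2 mu2 r%:C 1.
  by rewrite /alphaC mul1r rmorphM rmorphXn fmorphV.
have cur : on_curve r%:C 1.
  rewrite /on_curve invr1 !mulr1 -rmorphXn -!rmorphD -rmorphM -rmorphD.
  congr _%:C; rewrite -[RHS]mul1r -sum1 /r /rtot; field.
  by rewrite gt_eqF // addr_gt0.
have a'0 : (r ^+ 2 / r2)%:C != 0 by rewrite a'E alphaC_neq0 ?oner_neq0.
have cur' : on_curve r%:C (r ^+ 2 / r2)%:C.
  by rewrite a'E; apply: on_curve_alphaC cur; rewrite ?oner_neq0.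
have H := @bracket_pair_harmonic _ _ _ 1 (- ((1 - r) / (1 - r2 / r))%:C) r0
  (oner_neq0 _) a'0 cur cur'.
move=> y; have := H _ y; rewrite !mul1r !mulNr; apply.
rewrite /Ccoef divr1.
have -> : r%:C / (r ^+ 2 / r2)%:C = (r2 / r)%:C.
  rewrite -fmorphV -rmorphM /=; congr _%:C; field.
  by rewrite !gt_eqF.
rewrite -[1]/(1%:C) -!rmorphB /= -rmorphM /= divfK ?subrr //.
rewrite subr_eq0 eq_sym; apply: contra rr => /eqP e.
by rewrite -[r2](divfK (lt0r_neq0 r_gt0)) e mul1r.
Qed.

End Harmonic.

(** * Harmonicity and decay of [h_star], and the conclusion *)

Theorem proposition7p6
  (R : realType) (lam1 lam2 mu1 mu2 : R)
  (lam1_gt0 : 0 < lam1) (lam2_gt0 : 0 < lam2)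
  (mu1_gt0 : 0 < mu1) (mu2_gt0 : 0 < mu2)
  (sum1 : lam1 + lam2 + mu1 + mu2 = 1)
  (rho1_lt1 : rho lam1 mu1 < 1) (rho2_lt1 : rho lam2 mu2 < 1)
  (rho2_le_r : rho lam2 mu2 <= rtot lam1 lam2 mu1 mu2)
  (r_le_rho1 : rtot lam1 lam2 mu1 mu2 <= rho lam1 mu1)
  (rho_neq : rho lam1 mu1 != rho lam2 mu2)
  (r2rho2_lt1 : rtot lam1 lam2 mu1 mu2 ^+ 2 / rho lam2 mu2 < 1)
  (d : measure_display) (Omega : measurableType d) (P : probability Omega R)
  (J : nat -> Omega -> int * int)
  (J_iid : iid_increments P lam1 lam2 mu1 mu2 J)
  (rad : R) (rad_gt0 : 0 < rad) (rad_lt1 : rad < 1)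
  (radP : forall a : R[i], rad < cnorm a -> cnorm a <= 1 ->
     Num.max (cnorm (beta1 lam1 lam2 mu1 mu2 a))
             (cnorm (alphaC lam2 mu2 (beta1 lam1 lam2 mu1 mu2 a) a)) < 1)
  (K : nat) (c0 : R[i]) (c alpha : 'I_K -> R[i])
  (alpha_gt : forall k, rad < cnorm (alpha k))
  (alpha_le : forall k, cnorm (alpha k) <= 1)
  (alpha_def : forall k, h_beta1_defined lam1 lam2 mu1 mu2 (alpha k)) :
  let hstar := h_star lam1 lam2 mu1 mu2 c0 c alpha in
  let h := h_re lam1 lam2 mu1 mu2 c0 c alpha in
  [/\ Y_harmonic P J h,
      dB_determined P J h,
      (c_star hstar < +oo)%E &
      forall y, B y ->
        ((cnorm (hstar y - (fine (hit_prob P J y))%:C))%:E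
         <= c_star hstar * hit_prob P J y)%E].
Proof.
have m1 : 0 < mu1 + mu2 by rewrite addr_gt0.
have lt1 : lam1 < mu1 by move: rho1_lt1; rewrite /rho ltr_pdivrMr // mul1r.
have lt2 : lam2 < mu2 by move: rho2_lt1; rewrite /rho ltr_pdivrMr // mul1r.
(* As r is the mediant of rho1 and rho2, equality with rho2 would force rho1 = rho2. *)
have r_neq : rtot lam1 lam2 mu1 mu2 != rho lam2 mu2.
  apply: contra rho_neq; rewrite /rtot /rho !eqr_div ?lt0r_neq0 // => /eqP e.
  apply/eqP; apply: (addIr (lam2 * mu2)).
  by rewrite -mulrDl e mulrDr.
have r_gt0 : 0 < rtot lam1 lam2 mu1 mu2 by rewrite divr_gt0 ?addr_gt0.
have r_lt1 := le_lt_trans r_le_rho1 rho1_lt1.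
have rho1_gt0 : 0 < rho lam1 mu1 by rewrite divr_gt0.
have rho2_gt0 : 0 < rho lam2 mu2 by rewrite divr_gt0.
have a0 k : alpha k != 0.
  apply/eqP => e; have := lt_trans rad_gt0 (alpha_gt k).
  by rewrite e ComplexField.Normc.normc0 ltxx.
move=> hstar h.
have harm : step_harmonic lam1 lam2 mu1 mu2 hstar.
  apply: step_harmonicD; first apply: step_harmonicD.
  - exact: h_r_harmonic.
  - by apply: step_harmonicZ; exact: h_rho1_harmonic.
  - apply: step_harmonic_sum => k; apply: step_harmonicZ.
    exact: h_beta1_harmonic.
have dec : decaying hstar.
  apply: decayingD; first apply: decayingD.
  - rewrite /h_r; under eq_fun do rewrite -mulNr.
    apply: decayingD; [|apply: decayingZ]; apply: decaying_bracket;
      rewrite ?cnorm_real ?ComplexField.Normc.normc1 ?gtr0_norm //.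
      exact: ltW.
    by rewrite divr_gt0 // exprn_gt0.
  - apply: decayingZ; apply: decaying_bracket; rewrite cnorm_real gtr0_norm //.
    exact: ltW.
  - apply: decaying_sum => k; apply: decayingZ; rewrite /h_beta1.
    have := radP _ (alpha_gt k) (alpha_le k); rewrite gt_max => /andP[b1 a'1].
    under eq_fun do rewrite -mulNr.
    by apply: decayingD; apply: decayingZ; apply: decaying_bracket => //;
      exact: ltW.
split.
- exact: (Re_Y_harmonic sum1 J_iid harm).
- exact: (Re_dB_determined lam1_gt0 lam2_gt0 mu1_gt0 mu2_gt0 sum1 lt1 lt2 J_iid
    harm dec).
- exact: c_star_lty.
- exact: (relative_error lam1_gt0 lam2_gt0 mu1_gt0 mu2_gt0 sum1 lt1 lt2 J_iid
    harm dec).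
Qed.
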